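(* Let $\mathcal C$ be a small category. Every Grothendieck topology $J$ on $\mathcal C$ determines two distributivity forms over $\mathcal C$: (i) the covering form $J$, with the distributivity induced from the maximal distributivity of the form of sieves $\mathscr S$; (ii) the saturation form $\mathscr L_J$, whose admissible final lifts are $$\nabla_i(T_i,f_i)=j_J\Bigl(\bigcup_i f_iT_i\Bigr),\qquad T_i\in\mathscr L_J(X_i),\ f_i:X_i\to X.$$ Each local-equivalence class of sieves has the largest representative $j_J(S)$ ($S$ any member of the class), and these representatives are precisely the clusters of $\mathscr L_J$. If $\mathcal C$ has pullbacks, both distributivity forms are strong.
   Context: **Forms.** A form over $\mathcal C$ with finite indexed meets is a faithful amnestic functor $p:\mathcal E\to\mathcal C$ in which finite structured sources have initial lifts; equivalently a functor $F:\mathcal C^{\mathrm{op}}\to\mathbf{Meet}_\top$, where $\mathbf{Meet}_\top$ is the category of meet-semilattices with top and maps preserving finite meets (including top). Elements of $F_X$ are called clusters over $X$; $f^*:F_Y\to F_X$ is the action of $f:X\to Y$. A structured sink over $X$ is a small family $(A_i,f_i)_{i}$ with $f_i:X_i\to X$ and $A_i\in F_{X_i}$. Its final lift, if it exists, is the least $U\in F_X$ with $A_i\le f_i^*U$ for all $i$; one writes $U=\nabla_i(A_i,f_i)$, and the whole datum (sink and $U$) is a final presentation. **Distributivity forms.** A distributivity form is a form $F$ with finite indexed meets together with a class of final presentations, called admissible, such that: (D1) every unit presentation $A=\nabla(A,1_X)$ is admissible, and admissibility is invariant under bijective reindexing; (D2) if $U=\nabla_i(A_i,f_i)$ and $A_i=\nabla_j(B_{ij},g_{ij})$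 (all $i$) are admissible, so is $U=\nabla_{i,j}(B_{ij},f_ig_{ij})$; (D3) if $U=\nabla_i(A_i,f_i)$ is admissible and $C\in F_X$, then $U\wedge C=\nabla_i(A_i\wedge f_i^*C,f_i)$ is an admissible final presentation. It is strong if moreover: (D4) for every admissible $U=\nabla_i(A_i,f_i)$ over $X$ and $h:Y\to X$, with pullbacks $h_i:Y_i\to X_i$, $f_i':Y_i\to Y$ of $f_i$ and $h$, $h^*U=\nabla_i(h_i^*A_i,f_i')$ is an admissible final presentation. **Sieves.** $\mathscr S_X$ is the poset of sieves on $X$ ordered by inclusion, with $f^*S=\{g\mid fg\in S\}$. Every structured sink in $\mathscr S$ has final lift $\nabla_i(S_i,f_i)=\bigcup_i f_iS_i$, where $fR=\{fg\mid g\in R\}$; the maximal distributivity declares all of these admissible. **The two forms.** The covering form has fibre $J(X)$ (covering sieves) over $X$, with order, meets and inverse images as in $\mathscr S$; a presentation $U=\bigcup_if_iS_i$ is admissible in it when all $S_i$ and $U$ are covering. A sieve $S$ on $X$ covers $f:Y\to X$ when $f^*S\in J(Y)$; $j_J(S)=j_{J,X}(S)=\{f:Y\to X\mid f^*S\in J(Y)\}$. Two sieves on $X$ are locally equivalent when they cover the same arrows, i.e. have the same image under $j_J$. A sieve $S$ is $J$-saturated when $j_J(S)=S$; $\mathscr L_J(X)$ is the poset of saturated sieves on $X$, with meets and inverse images as in $\mathscr S$. All structured sinks in $\mathscr L_J$ are admissible. *)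

(* Defs.v *)
From HB Require Import structures.
From mathcomp Require Import all_boot all_order.
From mathcomp Require Import boolp.

Set Implicit Arguments.
Unset Strict Implicit.
Unset Printing Implicit Defensive.

Import Order.TTheory.
Local Open Scope order_scope.

Declare Scope cat_scope.
Delimit Scope cat_scope with cat.

Record category := Category {
  ob :> Type;
  hom : ob -> ob -> Type;
  idm : forall X, hom X X;
  compose : forall X Y Z, hom Y X -> hom Z Y -> hom Z X;
  compose1m : forall X Y (f : hom Y X), compose (idm X) f = f;
  composem1 : forall X Y (f : hom Y X), compose f (idm Y) = f;
  composeA : forall X Y Z W (f : hom Y X) (g : hom Z Y) (h : hom W Z),
    compose f (compose g h) = compose (compose f g) h
}.

Arguments hom {c}.
Arguments idm {c}.
Arguments compose {c X Y Z}.
Notation "f \o g" := (compose f g) : cat_scope.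
Local Open Scope cat_scope.

Definition is_pullback (C : category) (A B X P : C) (f : hom A X) (g : hom B X)
    (p : hom P A) (q : hom P B) : Prop :=
  f \o p = g \o q /\
  forall (Q : C) (a : hom Q A) (b : hom Q B), f \o a = g \o b ->
    exists! u : hom Q P, p \o u = a /\ q \o u = b.

Definition has_pullbacks (C : category) : Prop :=
  forall (A B X : C) (f : hom A X) (g : hom B X),
    exists (P : C) (p : hom P A) (q : hom P B), is_pullback f g p q.

(* A form with finite indexed meets, as a functor from the opposite of C to
   meet-semilattices with top. *)
Record form (d : Order.disp_t) (C : category) := Form {
  fibre :> C -> tMeetSemilatticeType d;
  pull : forall X Y, hom Y X -> fibre X -> fibre Y;
  pull1m : forall X (A : fibre X), pull (idm X) A = A;
  pullM : forall X Y Z (f : hom Y X) (g : hom Z Y) (A : fibre X),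
    pull (f \o g) A = pull g (pull f A);
  pullT : forall X Y (f : hom Y X), pull f \top = \top;
  pullI : forall X Y (f : hom Y X) (A B : fibre X),
    pull f (A `&` B) = pull f A `&` pull f B
}.

Arguments pull {d C} F {X Y} _ _ : rename.

Record sink d (C : category) (F : form d C) (X : C) := Sink {
  idx : Type;
  dom : idx -> C;
  arr : forall i, hom (dom i) X;
  clus : forall i, F (dom i)
}.

Arguments Sink {d C F X}.
Arguments dom {d C F X}.
Arguments arr {d C F X}.
Arguments clus {d C F X}.

Definition is_final_lift d (C : category) (F : form d C) (X : C)
    (s : sink F X) (U : F X) : Prop :=
  (forall i, clus s i <= pull F (arr s i) U) /\
  forall V : F X, (forall i, clus s i <= pull F (arr s i) V) -> U <= V.

Section SinkOperations.
Variables (d : Order.disp_t) (C : category) (F : form d C).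

Definition unit_sink (X : C) (A : F X) : sink F X :=
  Sink unit (fun=> X) (fun=> idm X) (fun=> A).

Definition reindex_sink (X : C) (s : sink F X) (I : Type) (e : I -> idx s) :
    sink F X :=
  Sink I (fun i => dom s (e i)) (fun i => arr s (e i)) (fun i => clus s (e i)).

Definition comp_sink (X : C) (s : sink F X) (t : forall i, sink F (dom s i)) :
    sink F X :=
  Sink {i : idx s & idx (t i)}
       (fun k => dom (t (tag k)) (tagged k))
       (fun k => arr s (tag k) \o arr (t (tag k)) (tagged k))
       (fun k => clus (t (tag k)) (tagged k)).

Definition meet_sink (X : C) (s : sink F X) (B : F X) : sink F X :=
  Sink (idx s) (dom s) (arr s) (fun i => clus s i `&` pull F (arr s i) B).

Definition pullback_sink (X Y : C) (s : sink F X) (dom' : idx s -> C)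
    (k : forall i, hom (dom' i) (dom s i)) (arr' : forall i, hom (dom' i) Y) :
    sink F Y :=
  Sink (idx s) dom' arr' (fun i => pull F (k i) (clus s i)).

End SinkOperations.

(* A class of presentations, [adm X s U] meaning that [U] presented as the
   final lift of the sink [s] belongs to the class. *)
Definition presentations d (C : category) (F : form d C) :=
  forall X : C, sink F X -> F X -> Prop.

Record is_distributivity d (C : category) (F : form d C)
    (adm : presentations F) : Prop := IsDistributivity {
  adm_final : forall X (s : sink F X) (U : F X),
    adm X s U -> is_final_lift s U;
  adm_unit : forall X (A : F X), adm X (unit_sink A) A;
  adm_reindex : forall X (s : sink F X) (U : F X) (I : Type) (e : I -> idx s),
    bijective e -> (adm X (reindex_sink e) U <-> adm X s U);
  adm_comp : forall X (s : sink F X) (t : forall i, sink F (dom s i)) (U : F X),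
    adm X s U -> (forall i, adm (dom s i) (t i) (clus s i)) ->
    adm X (comp_sink t) U;
  adm_meet : forall X (s : sink F X) (U B : F X),
    adm X s U -> adm X (meet_sink s B) (U `&` B)
}.

(* Stability is required for every choice of the pullback squares. *)
Definition is_strong_distributivity d (C : category) (F : form d C)
    (adm : presentations F) : Prop :=
  is_distributivity adm /\
  forall (X Y : C) (s : sink F X) (U : F X) (h : hom Y X)
    (dom' : idx s -> C) (k : forall i, hom (dom' i) (dom s i))
    (arr' : forall i, hom (dom' i) Y),
    (forall i, is_pullback (arr s i) h (k i) (arr' i)) ->
    adm X s U -> adm Y (pullback_sink k arr') (pull F h U).

Record is_subform d (C : category) (F : form d C)
    (P : forall X : C, F X -> Prop) : Prop := IsSubform {
  subformT : forall X, P X \top;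
  subformI : forall X (A B : F X), P X A -> P X B -> P X (A `&` B);
  subform_pull : forall X Y (f : hom Y X) (A : F X), P X A -> P Y (pull F f A)
}.

Section Subform.
Variables (d : Order.disp_t) (C : category) (F : form d C).
Variables (P : forall X : C, F X -> Prop) (HP : is_subform P).

(* The proof [HP] is a parameter so that the meet-semilattice structure can be
   inferred from the type. *)
Definition sub_fibre of is_subform P := fun X : C => {A : F X | `[< P A >]}.
Local Notation G := (sub_fibre HP).

HB.instance Definition _ X := SubChoice.on (G X).
HB.instance Definition _ X := [SubChoice_isSubPOrder of G X by <: with d].

Definition sub_meet X (A B : G X) : G X :=
  exist _ (val A `&` val B)
    (asboolT (subformI HP (asboolW (valP A)) (asboolW (valP B)))).

Definition sub_top X : G X := exist _ \top (asboolT (subformT HP X)).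

Definition sub_pull X Y (f : hom Y X) (A : G X) : G Y :=
  exist _ (pull F f (val A)) (asboolT (subform_pull HP f (asboolW (valP A)))).

Lemma sub_lexI X (A B D : G X) : (A <= sub_meet B D) = (A <= B) && (A <= D).
Proof. exact: lexI. Qed.

HB.instance Definition _ X :=
  Order.POrder_isMeetSemilattice.Build d (G X) (@sub_lexI X).

Lemma sub_lex1 X (A : G X) : A <= sub_top X.
Proof. exact: lex1. Qed.

HB.instance Definition _ X := Order.hasTop.Build d (G X) (@sub_lex1 X).

Lemma sub_pull1m X (A : G X) : sub_pull (idm X) A = A.
Proof. by apply: val_inj; rewrite /= pull1m. Qed.

Lemma sub_pullM X Y Z (f : hom Y X) (g : hom Z Y) (A : G X) :
  sub_pull (f \o g) A = sub_pull g (sub_pull f A).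
Proof. by apply: val_inj; rewrite /= pullM. Qed.

Lemma sub_pullT X Y (f : hom Y X) : sub_pull f \top = \top.
Proof. by apply: val_inj; rewrite /= pullT. Qed.

Lemma sub_pullI X Y (f : hom Y X) (A B : G X) :
  sub_pull f (A `&` B) = sub_pull f A `&` sub_pull f B.
Proof. by apply: val_inj; rewrite /= pullI. Qed.

Definition subform : form d C :=
  @Form d C (fun X => G X) sub_pull sub_pull1m sub_pullM sub_pullT sub_pullI.

Definition subform_sink (X : C) (s : sink subform X) : sink F X :=
  Sink (idx s) (dom s) (arr s) (fun i => val (clus s i : G (dom s i))).

Definition induced_adm (adm : presentations F) : presentations subform :=
  fun X s U => adm X (subform_sink s) (val (U : G X)).

End Subform.

Record sieve (C : category) (X : C) := Sieve {
  arrows :> forall Y : C, hom Y X -> Prop;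
  sieve_closed : forall (Y Z : C) (f : hom Y X) (g : hom Z Y),
    arrows f -> arrows (f \o g)
}.

Lemma sieve_ext (C : category) (X : C) (S R : sieve X) :
  (forall (Y : C) (f : hom Y X), S Y f <-> R Y f) -> S = R.
Proof.
case: S R => [S HS] [R HR] /= E.
have ES : S = R by apply: functional_extensionality_dep => Y; apply/funext => f; apply/propext.
by case: R / ES HR {E} => HR; rewrite (Prop_irrelevance HS HR).
Qed.

Fact sieve_display : Order.disp_t. Proof. exact: Order.Disp tt tt. Qed.

Section SieveForm.
Variable C : category.
Implicit Types X Y Z : C.

HB.instance Definition _ X := gen_eqMixin (sieve X).
HB.instance Definition _ X := gen_choiceMixin (sieve X).

Definition sieve_le X : rel (sieve X) :=
  fun S R => `[< forall Y (f : hom Y X), S Y f -> R Y f >].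

Lemma sieve_le_refl X : reflexive (@sieve_le X).
Proof. by move=> S; apply/asboolP. Qed.

Lemma sieve_le_anti X : antisymmetric (@sieve_le X).
Proof.
move=> S R /andP[/asboolP SR /asboolP RS]; apply: sieve_ext => Y f.
by split; [apply: SR | apply: RS].
Qed.

Lemma sieve_le_trans X : transitive (@sieve_le X).
Proof.
move=> R S T /asboolP SR /asboolP RT; apply/asboolP => Y f Sf.
exact/RT/SR.
Qed.

HB.instance Definition _ X := Order.Le_isPOrder.Build sieve_display (sieve X)
  (@sieve_le_refl X) (@sieve_le_anti X) (@sieve_le_trans X).

Definition sieve_meet X (S R : sieve X) : sieve X.
Proof.
apply: (@Sieve C X (fun Y f => S Y f /\ R Y f)) => Y Z f g [Sf Rf].
by split; apply: sieve_closed.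
Defined.

Lemma sieve_lexI X (S R T : sieve X) :
  (S <= sieve_meet R T) = (S <= R) && (S <= T).
Proof.
apply/asboolP/andP => [H|[/asboolP SR /asboolP ST] Y f Sf].
  by split; apply/asboolP => Y f /H[].
by split; [apply: SR | apply: ST].
Qed.

HB.instance Definition _ X :=
  Order.POrder_isMeetSemilattice.Build sieve_display (sieve X) (@sieve_lexI X).

Definition sieve_top X : sieve X := @Sieve C X (fun _ _ => True) (fun _ _ _ _ => id).

Lemma sieve_lex1 X (S : sieve X) : S <= sieve_top X.
Proof. exact/asboolP. Qed.

HB.instance Definition _ X :=
  Order.hasTop.Build sieve_display (sieve X) (@sieve_lex1 X).

Definition sieve_pull X Y (f : hom Y X) (S : sieve X) : sieve Y.
Proof.
apply: (@Sieve C Y (fun Z g => S Z (f \o g))) => Z W g h Sfg.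
by rewrite composeA; apply: sieve_closed.
Defined.

Lemma sieve_pull1m X (S : sieve X) : sieve_pull (idm X) S = S.
Proof. by apply: sieve_ext => Y f; rewrite /= compose1m. Qed.

Lemma sieve_pullM X Y Z (f : hom Y X) (g : hom Z Y) (S : sieve X) :
  sieve_pull (f \o g) S = sieve_pull g (sieve_pull f S).
Proof. by apply: sieve_ext => W h; rewrite /= composeA. Qed.

Lemma sieve_pullT X Y (f : hom Y X) : sieve_pull f \top = \top.
Proof. exact: sieve_ext. Qed.

Lemma sieve_pullI X Y (f : hom Y X) (S R : sieve X) :
  sieve_pull f (S `&` R) = sieve_pull f S `&` sieve_pull f R.
Proof. exact: sieve_ext. Qed.

Definition sieve_form : form sieve_display C :=
  @Form sieve_display C (fun X => sieve X)
    sieve_pull sieve_pull1m sieve_pullM sieve_pullT sieve_pullI.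

Definition sieve_push X Y (f : hom Y X) (S : sieve Y) : sieve X.
Proof.
apply: (@Sieve C X (fun Z h => exists2 g : hom Z Y, S Z g & h = f \o g)).
move=> Z W _ k [g Sg ->]; exists (g \o k); first exact: sieve_closed.
by rewrite composeA.
Defined.

Definition sieve_bigcup X (I : Type) (S : I -> sieve X) : sieve X.
Proof.
apply: (@Sieve C X (fun Y f => exists i, S i Y f)) => Y Z f g [i Sf].
by exists i; apply: sieve_closed.
Defined.

Definition sieve_lift X (s : sink sieve_form X) : sieve X :=
  sieve_bigcup (fun i => sieve_push (arr s i) (clus s i)).

(* The maximal distributivity of the form of sieves. *)
Definition sieve_adm : presentations sieve_form := fun X s U => U = sieve_lift s.

End SieveForm.

Record topology (C : category) := Topology {
  covering :> forall X : C, sieve X -> Prop;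
  coveringT : forall X : C, covering (\top : sieve X);
  covering_pull : forall (X Y : C) (f : hom Y X) (S : sieve X),
    covering S -> covering (sieve_pull f S);
  covering_trans : forall (X : C) (S R : sieve X), covering S ->
    (forall (Y : C) (f : hom Y X), S Y f -> covering (sieve_pull f R)) ->
    covering R
}.

Arguments covering {C} t X S.

Section Topology.
Variables (C : category) (J : topology C).
Implicit Types X Y : C.

Definition sieve_covers X Y (S : sieve X) (f : hom Y X) : Prop :=
  J Y (sieve_pull f S).

Definition saturation X (S : sieve X) : sieve X.
Proof.
apply: (@Sieve C X (fun Y f => sieve_covers S f)) => Y Z f g Sf.
by rewrite /sieve_covers sieve_pullM; apply: covering_pull.
Defined.

Definition saturated X (S : sieve X) : Prop := saturation S = S.

Definition locally_equivalent X (S R : sieve X) : Prop :=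
  forall Y (f : hom Y X), sieve_covers S f <-> sieve_covers R f.

Definition covering_adm (HJ : is_subform (F := sieve_form C) (covering J)) :
    presentations (subform HJ) :=
  induced_adm (@sieve_adm C).

Definition saturation_adm
    (HL : is_subform (F := sieve_form C) saturated) :
    presentations (subform HL) :=
  fun X s U => sval U = saturation (sieve_lift (subform_sink s)).

End Topology.

Arguments covering_adm {C J} HJ [X] s U.
Arguments saturation_adm {C J} HL [X] s U.

(* Main.v *)
Require Import Defs.
From HB Require Import structures.
From mathcomp Require Import all_boot all_order.
From mathcomp Require Import boolp.

(** Sieves form a distributivity for elementary reasons: a final lift is a union
of direct images, so the composition law is associativity of unions, the meet law
is the distribution of intersection over unions together with the projection
formula f S /\ B = f (S /\ f^* B), and stability under pullback is the
Beck-Chevalley condition h^* (f S) = f' (k^* S) for a pullback square.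

Covering sieves are closed under top, meets and inverse images, so they form a
subform. A final lift that lies in a subform is still final there, and the other
laws of a distributivity only assert that certain presentations are admissible;
hence a distributivity restricts to every subform ([induced_distributivity],
[induced_strong]). This settles the covering form.

For saturation, the axioms of a topology make [saturation J] a closure operator
that preserves meets and commutes with inverse images ([le_saturation],
[saturation_idem], [saturation_meet], [saturation_pull]). Saturated sieves are
its fixed points, hence a subform and exactly its image. The least saturated sieve
above a union is the saturation of that union, so all final lifts exist; the meet
and pullback laws follow by applying the closure to the corresponding identities
of sieves. Only composition asks for something new, namely that closing the
clusters of a sink before lifting does not change the saturated lift
([saturation_lift_comp]): a direct image of a closure lies in the closure of the
direct image, since inverse images of saturated sieves are saturated. *)

Set Implicit Arguments.
Unset Strict Implicit.
Unset Printing Implicit Defensive.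

Import Order.TTheory.
Local Open Scope order_scope.
Local Open Scope cat_scope.

(** * Distributivities restrict to subforms *)

Section InducedDistributivity.
Variables (d : Order.disp_t) (C : category) (F : form d C).
Variables (P : forall X : C, F X -> Prop) (HP : is_subform P).

Lemma subform_final_lift (X : C) (s : sink (subform HP) X) (U : subform HP X) :
  is_final_lift (subform_sink s) (sval U) -> is_final_lift s U.
Proof. by move=> [sU Umin]; split=> [i|V sV]; [exact: sU | exact: Umin]. Qed.

Variable adm : presentations F.

Lemma induced_distributivity :
  is_distributivity adm -> is_distributivity (induced_adm (HP := HP) adm).
Proof.
case=> final unit reindex comp meet; split.
- by move=> X s U /final; apply: subform_final_lift.
- by move=> X A; exact: (unit X (sval A)).
- by move=> X s U I e be; apply: (@reindex X (subform_sink s)).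
- move=> X s t U sU tU.
  exact: (@comp X (subform_sink s) (fun i => subform_sink (t i))).
- by move=> X s U B sU; exact: (@meet X (subform_sink s) _ (sval B)).
Qed.

Lemma induced_strong :
  is_strong_distributivity adm ->
  is_strong_distributivity (induced_adm (HP := HP) adm).
Proof.
case=> dist stable; split; first exact: induced_distributivity.
by move=> X Y s U h dom' k arr' pb sU; apply: (@stable X Y (subform_sink s)).
Qed.

End InducedDistributivity.

(** * The maximal distributivity of sieves *)

Section SieveLift.
Variable C : category.
Implicit Types X Y : C.

Lemma sieve_leP X (S R : sieve X) :
  reflect (forall Y (f : hom Y X), S Y f -> R Y f) (S <= R).
Proof. exact: asboolP. Qed.

Lemma sieve_lift_final X (s : sink (sieve_form C) X) :
  is_final_lift s (sieve_lift s).
Proof.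
split=> [i|V sV]; first by apply/sieve_leP => Y g sg; exists i, g.
by apply/sieve_leP => Y f [i [g sg ->]]; have /sieve_leP := sV i; apply.
Qed.

Lemma sieve_lift_unit X (A : sieve_form C X) : sieve_lift (unit_sink A) = A.
Proof.
apply: sieve_ext => Y f; split=> [[i [g Ag ->]]|Af]; first by rewrite compose1m.
by exists tt, f; rewrite //= compose1m.
Qed.

Lemma sieve_lift_reindex X (s : sink (sieve_form C) X) (I : Type)
    (e : I -> idx s) :
  bijective e -> sieve_lift (reindex_sink e) = sieve_lift s.
Proof.
case=> e' _ eK; apply: sieve_ext => Y f; split=> [[i sf]|[i]].
  by exists (e i).
by rewrite -(eK i) => sf; exists (e' i).
Qed.

Lemma sieve_lift_comp X (s : sink (sieve_form C) X)
    (t : forall i, sink (sieve_form C) (dom s i)) :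
  (forall i, clus s i = sieve_lift (t i)) ->
  sieve_lift (comp_sink t) = sieve_lift s.
Proof.
move=> st; apply: sieve_ext => Y f; split.
  move=> [[i j] /= [g tg ->]]; exists i, (arr (t i) j \o g).
    by rewrite st; exists j, g.
  by rewrite composeA.
move=> [i [g + ->]]; rewrite st => -[j [k tk ->]].
by exists (Tagged (fun i => idx (t i)) j), k; rewrite //= composeA.
Qed.

Lemma sieve_lift_meet X (s : sink (sieve_form C) X) (B : sieve_form C X) :
  sieve_lift (meet_sink s B) = sieve_lift s `&` B.
Proof.
apply: sieve_ext => Y f; split.
  by move=> [i [g [sg Bg] ->]]; split=> //; exists i, g.
by move=> [[i [g sg ->]] Bg]; exists i, g.
Qed.

Lemma sieve_lift_pullback X Y (s : sink (sieve_form C) X) (h : hom Y X)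
    (dom' : idx s -> C) (k : forall i, hom (dom' i) (dom s i))
    (arr' : forall i, hom (dom' i) Y) :
  (forall i, is_pullback (arr s i) h (k i) (arr' i)) ->
  sieve_lift (pullback_sink k arr') = sieve_pull h (sieve_lift s).
Proof.
move=> pb; apply: sieve_ext => Z g; split.
  move=> [i [u su ->]]; have [sq _] := pb i.
  by exists i, (k i \o u); rewrite // !composeA sq.
move=> [i [a sa hg]]; have [_ /(_ Z a g)] := pb i.
move=> [//|u [[ku hu] _]]; exists i, u => //=.
by rewrite ku.
Qed.

Lemma sieve_adm_distributivity : is_distributivity (@sieve_adm C).
Proof.
split.
- by move=> X s U ->; apply: sieve_lift_final.
- by move=> X A; rewrite /sieve_adm sieve_lift_unit.
- by move=> X s U I e be; rewrite /sieve_adm sieve_lift_reindex.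
- by move=> X s t U -> st; rewrite /sieve_adm sieve_lift_comp.
- by move=> X s U B ->; rewrite /sieve_adm sieve_lift_meet.
Qed.

Lemma sieve_adm_strong : is_strong_distributivity (@sieve_adm C).
Proof.
split; first exact: sieve_adm_distributivity.
by move=> X Y s U h dom' k arr' pb ->; rewrite /sieve_adm (sieve_lift_pullback pb).
Qed.

Lemma sieve_pullT_mem X Y (S : sieve X) (f : hom Y X) :
  S Y f -> sieve_pull f S = \top.
Proof. by move=> Sf; apply: sieve_ext => Z g; split=> // _; apply: sieve_closed. Qed.

Lemma le_sieve_pull X Y (f : hom Y X) (S R : sieve X) :
  S <= R -> sieve_pull f S <= sieve_pull f R.
Proof. by move/sieve_leP => SR; apply/sieve_leP => Z g; apply: SR. Qed.

End SieveLift.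

(** * Saturation is a closure operator *)

Section Saturation.
Variables (C : category) (J : topology C).
Implicit Types X Y : C.

Lemma covering_le X (S R : sieve X) : S <= R -> J X S -> J X R.
Proof.
move=> /sieve_leP SR JS; apply: (covering_trans JS) => Y f /SR Rf.
by rewrite sieve_pullT_mem //; apply: coveringT.
Qed.

Lemma covering_meet X (S R : sieve X) : J X S -> J X R -> J X (S `&` R).
Proof.
move=> JS JR; apply: (covering_trans JS) => Y f Sf.
by rewrite sieve_pullI sieve_pullT_mem // meet1x; apply: covering_pull.
Qed.

Lemma covering_subform : is_subform (F := sieve_form C) (covering J).
Proof.
by split; [exact: coveringT | exact: covering_meet | exact: covering_pull].
Qed.

Lemma le_saturation X (S : sieve X) : S <= saturation J S.
Proof.
apply/sieve_leP => Y f Sf; rewrite /= /sieve_covers sieve_pullT_mem //.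
exact: coveringT.
Qed.

Lemma saturation_homo X (S R : sieve X) :
  S <= R -> saturation J S <= saturation J R.
Proof.
by move=> SR; apply/sieve_leP => Y f; apply: covering_le; apply: le_sieve_pull.
Qed.

(** Idempotence is the local character axiom of a topology. *)
Lemma saturation_idem X (S : sieve X) :
  saturation J (saturation J S) = saturation J S.
Proof.
apply: le_anti; rewrite le_saturation andbT; apply/sieve_leP => Y f JSf.
by apply: (covering_trans JSf) => Z g; rewrite -sieve_pullM.
Qed.

Lemma saturation_meet X (S R : sieve X) :
  saturation J (S `&` R) = saturation J S `&` saturation J R.
Proof.
apply: sieve_ext => Y f; split=> [JSR|[JS JR]]; last first.
  by rewrite /= /sieve_covers sieve_pullI; apply: covering_meet.
by split; apply: covering_le JSR; apply: le_sieve_pull; rewrite (leIl, leIr).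
Qed.

Lemma saturation_pull X Y (f : hom Y X) (S : sieve X) :
  saturation J (sieve_pull f S) = sieve_pull f (saturation J S).
Proof.
by apply: sieve_ext => Z g; rewrite /= /sieve_covers sieve_pullM.
Qed.

Lemma saturation_le X (S V : sieve X) :
  saturated J V -> S <= V -> saturation J S <= V.
Proof. by move=> {2}<-; apply: saturation_homo. Qed.

Lemma saturated_subform : is_subform (F := sieve_form C) (saturated J).
Proof.
split=> [X|X A B HA HB|X Y f A HA].
- by apply: le_anti; rewrite lex1 le_saturation.
- by rewrite /saturated saturation_meet HA HB.
- by rewrite /saturated saturation_pull HA.
Qed.

Lemma locally_equivalentE X (S R : sieve X) :
  locally_equivalent J S R <-> saturation J S = saturation J R.
Proof.
split=> [SR|SR Y f]; first exact: sieve_ext.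
by change (saturation J S Y f <-> saturation J R Y f); rewrite SR.
Qed.

(** The composition law for saturated lifts. The inequality from left to right
holds because the composite lift, once saturated, pulls back along each arrow of
[s] to a saturated sieve containing the lift of [t i], hence also its saturation. *)
Lemma saturation_lift_comp X (s : sink (sieve_form C) X)
    (t : forall i, sink (sieve_form C) (dom s i)) :
  (forall i, clus s i = saturation J (sieve_lift (t i))) ->
  saturation J (sieve_lift s) = saturation J (sieve_lift (comp_sink t)).
Proof.
move=> st; have [sU smin] := sieve_lift_final s.
have [tU tmin] := sieve_lift_final (comp_sink t).
apply: le_anti; apply/andP; split.
  apply: saturation_le; first exact: saturation_idem.
  apply: smin => i; rewrite st /= -saturation_pull; apply: saturation_homo.
  have [_] := sieve_lift_final (t i); apply => j; rewrite -pullM.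
  exact: (tU (Tagged (fun i => idx (t i)) j)).
apply: saturation_homo; apply: tmin => -[i j]; rewrite pullM.
have [/(_ j) tij _] := sieve_lift_final (t i).
apply: le_trans tij _; apply: le_sieve_pull; apply: le_trans (sU i).
by rewrite st; apply: le_saturation.
Qed.

Variable HL : is_subform (F := sieve_form C) (saturated J).

Lemma subform_saturated X (A : subform HL X) : saturated J (sval A).
Proof. exact: asboolW (valP A). Qed.

Lemma saturation_distributivity : is_distributivity (saturation_adm HL).
Proof.
split.
- move=> X s U sU.
  have [ub least] := sieve_lift_final (subform_sink s); split=> [i|V sV].
    have liftU : sieve_lift (subform_sink s) <= sval U.
      by rewrite sU; apply: le_saturation.
    exact: le_trans (ub i) (le_sieve_pull _ liftU).
  change (sval U <= sval V); rewrite sU; apply: saturation_le.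
    exact: subform_saturated.
  exact: least.
- move=> X A; rewrite /saturation_adm.
  by rewrite (sieve_lift_unit (sval A : sieve_form C X)) subform_saturated.
- move=> X s U I e be; rewrite /saturation_adm.
  by rewrite (@sieve_lift_reindex C X (subform_sink s)).
- move=> X s t U sU tU; rewrite /saturation_adm sU.
  exact: (@saturation_lift_comp X (subform_sink s)
            (fun i => subform_sink (t i)) tU).
- move=> X s U B sU; rewrite /saturation_adm.
  rewrite (sieve_lift_meet (subform_sink s) (sval B)) saturation_meet.
  by rewrite subform_saturated -sU.
Qed.

Lemma saturation_strong : is_strong_distributivity (saturation_adm HL).
Proof.
split; first exact: saturation_distributivity.
move=> X Y s U h dom' k arr' pb sU; rewrite /saturation_adm.
rewrite (@sieve_lift_pullback C X Y (subform_sink s) h dom' k arr' pb).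
by rewrite saturation_pull -sU.
Qed.

End Saturation.

(** * The two forms of a topology *)

Theorem theorem1p8 (C : category) (J : topology C) :
  exists (HJ : is_subform (F := sieve_form C) (covering J))
         (HL : is_subform (F := sieve_form C) (saturated J)),
    [/\ is_distributivity (covering_adm HJ),
        is_distributivity (saturation_adm HL) /\
        (forall (X : C) (s : sink (subform HL) X),
          exists U : subform HL X, saturation_adm HL s U),
        (forall (X : C) (S : sieve X),
          locally_equivalent J S (saturation J S) /\
          forall R : sieve X, locally_equivalent J S R -> R <= saturation J S),
        (forall (X : C) (T : sieve X),
          (exists A : subform HL X, sval A = T) <->
          (exists S : sieve X, T = saturation J S))
      & has_pullbacks C ->
          is_strong_distributivity (covering_adm HJ) /\
          is_strong_distributivity (saturation_adm HL)].
Proof.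
exists (covering_subform J), (saturated_subform J); split.
- exact/induced_distributivity/sieve_adm_distributivity.
- split=> [|X s]; first exact: saturation_distributivity.
  pose U := saturation J (sieve_lift (subform_sink s)).
  by exists (exist _ U (asboolT (saturation_idem J _))).
- move=> X S; split=> [|R /locally_equivalentE ->]; last exact: le_saturation.
  by apply/locally_equivalentE; rewrite saturation_idem.
- move=> X T; split=> [[A <-]|[S ->]].
    by exists (sval A); rewrite subform_saturated.
  by exists (exist _ (saturation J S) (asboolT (saturation_idem J S))).
- move=> _; split; last exact: saturation_strong.
  exact/induced_strong/sieve_adm_strong.
Qed.
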